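(* Let $\boldsymbol w\in[0,\infty)^m$ be a simplex weight vector ($\sum_i w_i=1$). For every $\boldsymbol x\in[0,\infty)^m$, $$\mathbf 1\{\boldsymbol w^{\mathsf T}\boldsymbol x>1\}=\sum_{\varnothing\ne I\subseteq[m]}G_I(\boldsymbol x_I).$$ Consequently, the tail of a weighted sum is the sum of its one-coordinate contributions and of the interaction increments on all higher faces: for every $[0,\infty)^m$-valued random vector $\boldsymbol X$ and $t>0$, $$\Pr(\boldsymbol w^{\mathsf T}\boldsymbol X>t)=\sum_{i=1}^m\Pr(w_iX_i>t)+\sum_{I\subseteq[m],\,|I|\ge2}\mathbb E\,G_I(\boldsymbol X_I/t).$$
   Context: $[m]=\{1,\dots,m\}$ and $\boldsymbol x_I=(x_i)_{i\in I}$. For nonempty $I\subseteq[m]$ put $g_I(\boldsymbol x_I)=\mathbf 1\{\sum_{i\in I}w_ix_i>1\}$, put $g_\varnothing=0$, and define the face increment $$G_I(\boldsymbol x_I)=\sum_{J\subseteq I}(-1)^{|I|-|J|}g_J(\boldsymbol x_J).$$ *)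

(* Defs.v *)
From HB Require Import structures.
From mathcomp Require Import all_boot all_order all_algebra.
From mathcomp Require Import all_classical all_reals all_analysis.

Set Implicit Arguments.
Unset Strict Implicit.
Unset Printing Implicit Defensive.

Import Order.TTheory GRing.Theory Num.Theory.

Local Open Scope ring_scope.

(* A vector of R^m is a function 'I_m -> R; a random vector is a random
   variable with values in m.-tuple R, which carries the product sigma-algebra,
   and tnth turns its values into functions. *)

Definition simplex_weights (R : realType) (m : nat) (w : 'I_m -> R) : Prop :=
  (forall i, 0 <= w i) /\ \sum_(i < m) w i = 1.

(* [face_exceed w I x] is g_I(x_I) and [face_increment w I x] is G_I(x_I): they
   take the whole vector x but only read its coordinates in I, which avoids a
   family of domains R^I and the restriction maps between them. *)
Definition face_exceed (R : realType) (m : nat) (w : 'I_m -> R)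
    (I : {set 'I_m}) (x : 'I_m -> R) : R :=
  if I == finset.set0 then 0 else (1 < \sum_(i in I) w i * x i)%R%:R.

Definition face_increment (R : realType) (m : nat) (w : 'I_m -> R)
    (I : {set 'I_m}) (x : 'I_m -> R) : R :=
  \sum_(J : {set 'I_m} | J \subset I)
    (-1) ^+ (#|I| - #|J|) * face_exceed w J x.

(* Main.v *)
(* Summing the face increments over all I and exchanging the sums leaves, for
   each J, the coefficient \sum_(I >= J) (-1)^|I \ J|, which vanishes unless J is
   the whole index set. As G_I is 0 for I empty and the exceedance indicator of
   one coordinate for I a singleton, taking expectations gives the tail formula. *)

Require Import Defs.
From HB Require Import structures.
From mathcomp Require Import all_boot all_order all_algebra.
From mathcomp Require Import all_classical all_reals all_analysis.
From mathcomp Require Import measurable_realfun.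

Set Implicit Arguments.
Unset Strict Implicit.
Unset Printing Implicit Defensive.

Import Order.TTheory GRing.Theory Num.Theory.

Local Open Scope classical_set_scope.
Local Open Scope ring_scope.

Lemma sum_sign_supset (R : comNzRingType) (T : finType) (J : {set T}) :
  \sum_(I : {set T} | J \subset I) (-1) ^+ (#|I| - #|J|) =
  (J == finset.setT)%:R :> R.
Proof.
(* Expand the product over [i] of [1] if [i \in J] and [-1 + 1] otherwise. *)
transitivity (\prod_(i : T)
    ((if i \in J then 1 else -1) + (if i \in J then 0 else 1)) : R).
  rewrite bigA_distr big_mkcond; apply: eq_bigr => I _.
  (* The term of [I] takes the first summand on [I] and the second off [I]. A point of [J] outside
     [I] gives a factor 0; if [J \subset I], each point of [I] outside [J] gives -1 and all others
     give 1. *)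
  have [JI|/fintype.subsetPn[i iJ iI]] := boolP (J \subset I); last first.
    by rewrite (bigD1 i)//= (negbTE iI) iJ mul0r.
  rewrite -cardsDS// -prodr_const [LHS]big_mkcond; apply: eq_bigr => i _.
  rewrite !inE; have [iJ|] := boolP (i \in J); first by rewrite (fintype.subsetP JI).
  by case: (i \in I).
have [->|] := eqVneq J finset.setT.
  by rewrite big1// => i _; rewrite inE addr0.
rewrite -finset.subTset => /fintype.subsetPn[i _ iJ].
by rewrite (bigD1 i)//= (negbTE iJ) addNr mul0r.
Qed.

(** Möbius inversion in the lattice of subsets, evaluated at its top element. *)
Lemma sum_subset_inversion (R : comNzRingType) (T : finType)
    (g : {set T} -> R) :
  \sum_(I : {set T}) \sum_(J : {set T} | J \subset I)
    (-1) ^+ (#|I| - #|J|) * g J = g finset.setT.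
Proof.
rewrite (exchange_big_dep predT)//=.
under eq_bigr do rewrite -big_distrl/= sum_sign_supset.
rewrite (bigD1 finset.setT)//= eqxx mul1r big1 ?addr0// => J /negbTE->.
by rewrite mul0r.
Qed.

Section Faces.
Variables (R : realType) (m : nat) (w : 'I_m -> R).
Implicit Types (I : {set 'I_m}) (x : 'I_m -> R).

(** The convention at the empty face agrees with the general formula, since the empty sum 0 does not
    exceed 1. *)
Lemma face_exceedE I x :
  face_exceed w I x = (1 < \sum_(i in I) w i * x i)%R%:R.
Proof.
by rewrite /face_exceed; case: eqP => [->|//]; rewrite big_set0 ltr10.
Qed.

Lemma face_increment0 x : face_increment w finset.set0 x = 0.
Proof.
rewrite /face_increment big1// => J; rewrite finset.subset0 => /eqP->.
by rewrite /face_exceed eqxx mulr0.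
Qed.

Lemma face_increment1 i x : face_increment w [set i]%SET x = (1 < w i * x i)%R%:R.
Proof.
rewrite /face_increment (bigD1 [set i]%SET)//= subnn mul1r face_exceedE big_set1.
rewrite big1 ?addr0// => J; rewrite finset.subset1 => /andP[/orP[->//|/eqP->] _].
by rewrite /face_exceed eqxx mulr0.
Qed.

Lemma sum_face_increment x :
  \sum_(I : {set 'I_m} | I != finset.set0) face_increment w I x =
  (1 < \sum_(i < m) w i * x i)%R%:R.
Proof.
(* The inversion runs over all subsets; the empty face can be added because its increment is 0. *)
transitivity (\sum_(I : {set 'I_m}) face_increment w I x).
  by rewrite [RHS](bigD1 finset.set0)//= face_increment0 add0r.
rewrite sum_subset_inversion face_exceedE.
by under eq_bigl do rewrite inE.
Qed.

End Faces.

Section Expectation.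
Context (R : realType) (d : measure_display) (T : measurableType d).
Variable P : probability T R.

Lemma measurable_set_gt (c : R) (f : T -> R) :
  measurable_fun setT f -> measurable [set omega | c < f omega].
Proof.
move=> mf; have := mf measurableT _ (measurable_itv `]c, +oo[).
by rewrite setTI preimage_itvoy.
Qed.

Lemma indic_gtE (c : R) (f : T -> R) :
  (fun omega => (c < f omega)%R%:R) = \1_[set omega | c < f omega] :> (T -> R).
Proof.
apply/funext => omega; rewrite indicE; congr ((nat_of_bool _)%:R).
by apply/idP/idP; rewrite inE.
Qed.

Lemma integrable_indic_gt (c : R) (f : T -> R) : measurable_fun setT f ->
  P.-integrable setT (fun omega => (c < f omega)%R%:R%:E).
Proof.
move=> mf; have /= := integrable_indic P (measurable_set_gt c mf).
by rewrite -indic_gtE.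
Qed.

Lemma expectation_indic_gt (c : R) (f : T -> R) : measurable_fun setT f ->
  ('E_P[fun omega => (c < f omega)%R%:R] = P [set omega | (c < f omega)%R])%E.
Proof.
by move=> mf; rewrite indic_gtE expectation_indic//; exact: measurable_set_gt.
Qed.

Variables (m : nat) (w : 'I_m -> R) (Y : 'I_m -> T -> R).
Hypothesis mY : forall i, measurable_fun setT (Y i).

Lemma integrable_face_increment (I : {set 'I_m}) :
  P.-integrable setT (fun omega => (face_increment w I (Y^~ omega))%:E).
Proof.
rewrite (_ : (fun _ => _) = fun omega => (\sum_(J : {set 'I_m} | J \subset I)
    ((-1) ^+ (#|I| - #|J|) * face_exceed w J (Y^~ omega))%:E)%E); last first.
  by apply/funext => omega; rewrite sumEFin.
apply: integrable_sum => // J _.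
(* Each summand is a constant times an exceedance indicator; padding its inner sum with zeros
   outside [J] makes it range over all coordinates, as [measurable_sum] expects. *)
under eq_fun do rewrite EFinM face_exceedE big_mkcond/=.
apply: integrableZl; first exact: measurableT.
apply: integrable_indic_gt.
apply: measurable_sum => i; case: (i \in J); last exact: measurable_cst.
exact: measurable_funM.
Qed.

(** The tail formula at threshold 1; a threshold [t] is reached by taking the coordinates divided by
    [t] for [Y]. *)
Lemma tail_face_decomposition :
  (P [set omega | (1 < \sum_(i < m) w i * Y i omega)%R] =
   \sum_(i < m) P [set omega | (1 < w i * Y i omega)%R] +
   \sum_(I : {set 'I_m} | (2 <= #|I|)%N)
     'E_P[fun omega => face_increment w I (Y^~ omega)])%E.
Proof.
have mwY i : measurable_fun setT (fun omega => w i * Y i omega).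
  exact: measurable_funM.
rewrite -expectation_indic_gt; last exact: measurable_sum.
transitivity (\sum_(I : {set 'I_m} | I != finset.set0)
    'E_P[fun omega => face_increment w I (Y^~ omega)])%E.
  (* The pointwise identity is integrated term by term, each increment being integrable. *)
  under eq_fun do rewrite -sum_face_increment.
  rewrite unlock -integral_sum//; last exact: integrable_face_increment.
  by apply: eq_integral => omega _; rewrite sumEFin.
rewrite (bigID (fun I : {set 'I_m} => #|I| == 1%N))/=; congr (_ + _)%E; last first.
  by apply: eq_bigl => I; rewrite -card_gt0; case: #|I| => [|[]].
(* The faces of cardinality 1 are the image of the injective map sending [i] to its singleton, so
   their sum is reindexed by coordinates. *)
rewrite [LHS](eq_bigl (mem [set [set i]%SET | i : 'I_m]%SET)); last first.
  move=> I; apply/andP/imsetP => [[_ /cards1P[i ->]]|[i _ ->]]; first by exists i.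
  by rewrite cards1 -card_gt0 cards1.
rewrite big_imset/=; last by move=> i j _ _; exact: finset.set1_inj.
apply: eq_bigr => i _; rewrite -expectation_indic_gt//.
by congr ('E_P[_])%E; apply/funext => omega; rewrite face_increment1.
Qed.

End Expectation.

Theorem mainTheorem3 (R : realType) (m : nat) (w : 'I_m -> R)
    (hw : simplex_weights w) :
  (forall x : 'I_m -> R, (forall i, 0 <= x i) ->
     (1 < \sum_(i < m) w i * x i)%R%:R =
     \sum_(I : {set 'I_m} | I != finset.set0) face_increment w I x)
  /\
  (forall (d : measure_display) (T : measurableType d) (P : probability T R)
     (X : {RV P >-> m.-tuple R}) (t : R),
     (forall omega i, 0 <= tnth (X omega) i) -> 0 < t ->
     (P [set omega | (t < \sum_(i < m) w i * tnth (X omega) i)%R] =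
      \sum_(i < m) P [set omega | (t < w i * tnth (X omega) i)%R] +
      \sum_(I : {set 'I_m} | (2 <= #|I|)%N)
        'E_P[fun omega => face_increment w I (fun i => (tnth (X omega) i / t)%R)])%E).
Proof.
split=> [x _|d T P X t _ t0]; first by rewrite sum_face_increment.
have mXt i : measurable_fun setT (fun omega => tnth (X omega) i / t).
  apply: measurable_funM => //.
  apply: (measurableT_comp (measurable_tnth i)).
  exact: measurable_funPT.
have := tail_face_decomposition P w mXt.
(* Pull the factor [t^-1] out of the sum and clear it, using [0 < t], to move the threshold from 1
   to [t]. *)
under eq_set do (under eq_bigr do rewrite mulrA; rewrite -mulr_suml ltr_pdivlMr// mul1r).
move=> ->; congr (_ + _)%E; apply: eq_bigr => i _; congr (P _).
by under eq_set do rewrite mulrA ltr_pdivlMr// mul1r.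
Qed.
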